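(* Let $\lambda,\lambda_1,\alpha,\beta>0$. Let $N_1$ be a Poisson process with intensity $\lambda_1$, and let $G_N(t)=G(N(t))$ be a compound Poisson-Gamma process with parameters $\lambda,\alpha,\beta$, independent of $N_1$. Put $X(t)=N_1(G_N(t))$ and $p_k(t)=P(X(t)=k)$, $t\ge 0$. Then for $k\ge 1$ $$p_k(t)=\frac{e^{-\lambda t}}{k!}\,\frac{\lambda_1^{k}}{(\lambda_1+\beta)^{k}}\sum_{n=1}^{\infty}\frac{(\lambda t\beta^{\alpha})^{n}\,\Gamma(\alpha n+k)}{(\lambda_1+\beta)^{\alpha n}\,n!\,\Gamma(\alpha n)},$$ and $$p_0(t)=\exp\left\{-\lambda t\left(1-\frac{\beta^{\alpha}}{(\lambda_1+\beta)^{\alpha}}\right)\right\}.$$ Moreover, the probabilities $p_k(t)$, $k\ge 0$, satisfy the system of difference-differential equations $$\frac{d}{dt}p_k(t)=\left(\frac{\lambda\beta^{\alpha}}{(\lambda_1+\beta)^{\alpha}}-\lambda\right)p_k(t)+\frac{\lambda\beta^{\alpha}}{(\lambda_1+\beta)^{\alpha}}\sum_{m=1}^{k}\frac{\lambda_1^{m}}{(\lambda_1+\beta)^{m}}\,\frac{\Gamma(m+\alpha)}{m!\,\Gamma(\alpha)}\,p_{k-m}(t),$$ where the sum is empty (equal to $0$) for $k=0$.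
   Context: The compound Poisson-Gamma process with parameters $\lambda,\alpha,\beta$ is $G_N(t)=G(N(t))$, where $N$ is a Poisson process with intensity $\lambda$ and $G$ is a Gamma process independent of $N$, i.e. a Lévy process with $G(0)=0$ such that $G(t)$, $t>0$, has density $\frac{\beta^{\alpha t}}{\Gamma(\alpha t)}x^{\alpha t-1}e^{-\beta x}$ on $x>0$. Equivalently, $G_N(t)=\sum_{n=1}^{N(t)}G_n$ with $G_n$ i.i.d. Gamma with shape $\alpha$ and rate $\beta$, independent of $N$ (empty sum $=0$). *)

(* Defs.v *)
From HB Require Import structures.
From mathcomp Require Import all_boot all_order all_algebra.
From mathcomp Require Import all_classical all_reals all_analysis.

Set Implicit Arguments.
Unset Strict Implicit.
Unset Printing Implicit Defensive.

Import Order.TTheory GRing.Theory Num.Theory.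
Import numFieldNormedType.Exports.

Local Open Scope classical_set_scope.
Local Open Scope ring_scope.

(* Processes are functions R -> T -> U of time and outcome. The time axis is
   [0, +oo[: no condition is ever imposed on the values at negative times. *)

Definition indep_vars d (T : measurableType d) (R : realType)
    (P : probability T R) (n : nat) (Y : nat -> T -> R) : Prop :=
  forall B : nat -> set R, (forall i, measurable (B i)) ->
    (P (\bigcap_(i < n) (Y i @^-1` B i)) =
     \prod_(0 <= i < n) P (Y i @^-1` B i))%E.

Definition process_sigma d (T : measurableType d) (R : realType)
    d' (U : measurableType d') (X : R -> T -> U) : set (set T) :=
  <<s [set A | exists2 t : R, 0 <= t &
               exists2 B : set U, measurable B & A = X t @^-1` B] >>.

Definition indep_processes d (T : measurableType d) (R : realType)
    (P : probability T R) d1 (U : measurableType d1)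
    d2 (V : measurableType d2) (X : R -> T -> U) (Y : R -> T -> V) : Prop :=
  forall A B, process_sigma X A -> process_sigma Y B ->
    (P (A `&` B) = P A * P B)%E.

Definition cadlag (R : realType) (f : R -> R) : Prop :=
  (forall t : R, 0 <= t -> f s @[s --> t^'+] --> f t) /\
  (forall t : R, 0 < t -> cvg (f s @[s --> t^'-])).

(* The start at 0 and the path regularity are required for every outcome. *)
Record levy_process d (T : measurableType d) (R : realType)
    (P : probability T R) (X : R -> T -> R) : Prop := LevyProcess {
  levy_measurable : forall t : R, 0 <= t -> measurable_fun [set: T] (X t) ;
  levy_start : forall w, X 0 w = 0 ;
  levy_indep_increments : forall (n : nat) (s : nat -> R),
    0 <= s 0%N -> {homo s : i j / (i <= j)%N >-> i <= j} ->
    indep_vars P n (fun i w => X (s i.+1) w - X (s i) w) ;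
  levy_stationary_increments : forall (s h : R) (B : set R),
    0 <= s -> 0 <= h -> measurable B ->
    P ((fun w => X (s + h) w - X s w) @^-1` B) = P (X h @^-1` B) ;
  levy_cadlag : forall w, cadlag (X ^~ w)
}.

(* The marginal law is prescribed at t > 0 only: poisson_pmf is meaningless at
   rate 0, and N 0 = 0 is part of levy_process. *)
Definition poisson_process d (T : measurableType d) (R : realType)
    (P : probability T R) (lambda : R) (N : R -> T -> nat) : Prop :=
  levy_process P (fun t w => (N t w)%:R) /\
  forall (t : R) k, 0 < t ->
    P [set w | N t w = k] = (poisson_pmf (lambda * t) k)%:E.

(* Euler's Gamma function, meaningful for a > 0. *)
Definition Gamma (R : realType) (a : R) : R :=
  \int[@lebesgue_measure R]_(x in `]0, +oo[) (x `^ (a - 1) * expR (- x)).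

Definition gamma_pdf (R : realType) (a b x : R) : R :=
  b `^ a / Gamma a * x `^ (a - 1) * expR (- b * x).

(* The state space of a Gamma process is [0, +oo[ (it is used as a random time
   below), so nonnegativity is required for every outcome. *)
Definition gamma_process d (T : measurableType d) (R : realType)
    (P : probability T R) (alpha beta : R) (G : R -> T -> R) : Prop :=
  [/\ levy_process P G,
      forall (t : R) w, 0 <= t -> 0 <= G t w &
      forall (t : R) (B : set R), 0 < t -> measurable B ->
        P (G t @^-1` B) =
        (\int[@lebesgue_measure R]_(x in B `&` `]0%R, +oo[)
           (gamma_pdf (alpha * t) beta x)%:E)%E].

Definition compound_poisson_gamma d (T : measurableType d) (R : realType)
    (P : probability T R) (lambda alpha beta : R) (Y : R -> T -> R) : Prop :=
  exists (N : R -> T -> nat) (G : R -> T -> R),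
    [/\ poisson_process P lambda N, gamma_process P alpha beta G,
        indep_processes P N G &
        forall (t : R) w, 0 <= t -> Y t w = G (N t w)%:R w].

Definition time_change (T R U : Type) (N : R -> T -> U) (Y : R -> T -> R) :
  R -> T -> U := fun t w => N (Y t w) w.

Definition state_prob d (T : measurableType d) (R : realType)
    (P : probability T R) (X : R -> T -> nat) (k : nat) (t : R) : R :=
  fine (P [set w | X t w = k]).

(* Main.v *)
Require Import Defs.
From HB Require Import structures.
From mathcomp Require Import all_boot all_order all_algebra.
From mathcomp Require Import all_classical all_reals all_analysis.
From mathcomp Require Import measurable_realfun ring lra.

(* Independence and right-continuity of the paths of N1 give
   P(X(t) = k) = E[q_k(G_N(t))], where q_k(s) = P(N1(s) = k): approximate the
   random time G_N(t) by discrete times strictly above it. Conditioning on the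
   inner Poisson process N, E[q_k(G(n))] is a Gamma integral, namely the negative
   binomial weight c(k, n) with shape alpha n, so that
     p_k(t) = e^(-lambda t) sum_n (lambda t)^n / n! c(k, n).
   Differentiating this power series replaces c(k, n) by
   lambda (c(k, n+1) - c(k, n)), and Vandermonde's identity for rising
   factorials gives c(k, n+1) = sum_m c(m, 1) c(k-m, n), which is the system of
   equations. Finiteness and positivity of Gamma come for free from the total
   mass of the law of the Gamma process. *)

Set Implicit Arguments.
Unset Strict Implicit.
Unset Printing Implicit Defensive.

Import Order.TTheory GRing.Theory Num.Theory.
Import numFieldNormedType.Exports.

Local Open Scope classical_set_scope.
Local Open Scope ring_scope.

(** * Integrals against image measures, and scaling of Lebesgue measure *)

Section Integration.
Local Open Scope ereal_scope.

(* Both sides are monotone continuous in [f], so indicators decide. *)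
Lemma ge0_integral_density d d' (T : measurableType d) (U : measurableType d')
    (R : realType) (nu : {measure set T -> \bar R})
    (mu : {measure set U -> \bar R}) (Y : U -> T) (g : U -> R) (D : set U)
    (f : T -> \bar R) :
  measurable D -> measurable_fun setT Y -> measurable_fun D g ->
  (forall x, D x -> (0 <= g x)%R) ->
  (forall B, measurable B -> nu B = \int[mu]_(x in D `&` Y @^-1` B) (g x)%:E) ->
  measurable_fun setT f -> (forall x, 0 <= f x) ->
  \int[nu]_x f x = \int[mu]_(x in D) ((g x)%:E * f (Y x)).
Proof.
Import HBNNSimple.
move=> mD mY mg g0 nuE mf f0.
pose f_ := nnsfun_approx measurableT mf.
have mfY n : measurable_fun D (fun x => (f_ n (Y x))%:E).
  apply: measurable_funTS; apply/measurable_EFinP.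
  by apply: measurableT_comp => //; exact: measurable_funP.
have mgE : measurable_fun D (fun x => (g x)%:E) by exact/measurable_EFinP.
have sfE n : \int[nu]_x (f_ n x)%:E = \int[mu]_(x in D) ((g x)%:E * (f_ n (Y x))%:E).
  under [LHS]eq_integral do rewrite fimfunE -fsumEFin//.
  rewrite [LHS]ge0_integral_fsum//; last 2 first.
  - by move=> r; exact/measurable_EFinP/measurableT_comp.
  - by move=> r x _; rewrite EFinM nnfun_muleindic_ge0.
  under [RHS]eq_integral.
    move=> x xD; rewrite fimfunE -fsumEFin// ge0_mule_fsumr; last first.
      by move=> r; rewrite EFinM nnfun_muleindic_ge0.
    over.
  rewrite [RHS]ge0_integral_fsum//; last 2 first.
  - move=> r; apply: emeasurable_funM => //; apply/measurable_EFinP.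
    apply: measurable_funTS; apply: measurableT_comp => //.
    exact: measurableT_comp.
  - move=> r x Dx; rewrite mule_ge0//; first by rewrite lee_fin g0.
    by rewrite EFinM nnfun_muleindic_ge0.
  apply: eq_fsbigr => r _.
  rewrite integralZl_indic_nnsfun//= integral_indic// setIT nuE//.
  have mI : measurable_fun D (fun x => (\1_(f_ n @^-1` [set r]) (Y x))%:E : \bar R).
    apply/measurable_EFinP; apply: measurable_funTS.
    exact: measurableT_comp.
  have [r0|r0] := leP 0%R r; last first.
    rewrite preimage_nnfun0// preimage_set0 setI0 integral_set0 mule0.
    rewrite integral0_eq// => x Dx; rewrite indicE in_set0 mulr0 mule0//.
  have mfr : measurable (Y @^-1` (f_ n @^-1` [set r])).
    by rewrite -[X in measurable X]setTI; exact: mY.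
  rewrite -ge0_integralZl ?lee_fin//; last 3 first.
  - exact: measurableI.
  - by apply: measurable_funS mgE => //; exact: subIsetl.
  - by move=> x [Dx _]; rewrite lee_fin g0.
  rewrite setIC integral_mkcondl; apply: eq_integral => x xD.
  rewrite patchE/= indicE.
  have -> : (x \in Y @^-1` (f_ n @^-1` [set r])) = (Y x \in f_ n @^-1` [set r]).
    by apply/idP/idP; rewrite !inE.
  by case: ifPn => xf; rewrite ?mulr1 ?mulr0 ?mule0// muleC.
transitivity (lim (\int[nu]_x (f_ n x)%:E @[n --> \oo])).
  rewrite -monotone_convergence//=.
  - apply: eq_integral => x _; apply/esym/cvg_lim => //=.
    exact: cvg_nnsfun_approx.
  - by move=> n; exact/measurable_EFinP/measurable_funTS.
  - by move=> n ? _; rewrite lee_fin.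
  - by move=> ? _ ? ? mn; rewrite lee_fin; exact/lefP/nd_nnsfun_approx.
under eq_fun do rewrite sfE.
rewrite -monotone_convergence//=.
- apply: eq_integral => x xD; apply/cvg_lim => //=.
  by apply: cvgeZl => //; exact: cvg_nnsfun_approx.
- by move=> n; exact: emeasurable_funM.
- by move=> n x Dx; rewrite mule_ge0// lee_fin ?g0.
- move=> x Dx m n mn; rewrite lee_wpmul2l// ?lee_fin ?g0//.
  exact/lefP/nd_nnsfun_approx.
Qed.

(** Independence says that restricting [P] to [A] and pushing forward by [Y] gives the law of [Y]
    scaled by [P A]; this is the density lemma with density 1 on [A]. *)
Lemma integral_indep d (T : measurableType d) (R : realType)
    (P : probability T R) (A : set T) (Y : T -> R) (f : R -> \bar R) :
  measurable A -> measurable_fun setT Y ->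
  (forall B, measurable B -> P (A `&` Y @^-1` B) = P A * P (Y @^-1` B)) ->
  measurable_fun setT f -> (forall x, 0 <= f x) ->
  \int[P]_(w in A) f (Y w) = P A * \int[P]_w f (Y w).
Proof.
move=> mA mY indA mf f0.
have PA : P A = (fine (P A))%:E by rewrite fineK// fin_num_measure.
pose PY : {measure set R -> \bar R} :=
  measure_function_pushforward__canonical__measure_function_Measure P mY.
pose k : {nonneg R} := NngNum (fine_ge0 (measure_ge0 P A)).
transitivity (\int[mscale k PY]_x f x).
  rewrite (@ge0_integral_density _ _ _ _ _ _ P Y (cst 1%R) A)//.
  - by apply: eq_integral => w _; rewrite mul1e.
  - move=> B mB; rewrite (integral_cst P _ 1)/=; last first.
      by apply: measurableI => //; rewrite -[X in measurable X]setTI; exact: (mY).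
    by rewrite mul1e indA// [in RHS]PA.
rewrite ge0_integral_mscale//= -PA; congr (_ * _).
by rewrite ge0_integral_pushforward.
Qed.

(** Freezes a random index: on the event [J = j] the integrand is [f j]. It serves both for
    discretised times and for conditioning on the inner Poisson process. *)
Lemma ge0_integral_nat_partition d (T : measurableType d) (R : realType)
    (mu : {measure set T -> \bar R}) (J : T -> nat) (f : nat -> T -> \bar R) :
  (forall j, measurable (J @^-1` [set j])) ->
  (forall j, measurable_fun setT (f j)) -> (forall j w, 0 <= f j w) ->
  \int[mu]_w f (J w) w = \sum_(j <oo) \int[mu]_(w in J @^-1` [set j]) f j w.
Proof.
move=> mJ mf f0.
have JT : \bigcup_j (J @^-1` [set j]) = setT.
  by apply/seteqP; split => // w _; exists (J w).
rewrite -JT ge0_integral_bigcup//.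
- by apply: eq_eseriesr => j _; apply: eq_integral => w; rewrite inE/= => ->.
- apply/measurable_fun_bigcup => // j.
  apply: (eq_measurable_fun (f j)); last exact: measurable_funTS.
  by move=> w; rewrite inE/= => ->.
- by apply/trivIsetP => i j _ _ ij; apply/seteqP; split => // w [/= Ji Jj];
    rewrite -Ji -Jj eqxx in ij.
Qed.

(** By uniqueness of Lebesgue measure it suffices to compare lengths of half-open intervals. *)
Lemma lebesgue_measure_scale (R : realType) (c : R) (A : set R) :
  (0 < c)%R -> measurable A ->
  c%:E * lebesgue_measure ((fun x => c * x)%R @^-1` A) = lebesgue_measure A.
Proof.
move=> c0 mA.
have mc : measurable_fun setT ((fun x => c * x)%R : R -> measurableTypeR R).
  by apply: measurable_funM.
pose k : {nonneg R} := NngNum (ltW c0).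
pose mc' : {measure set (measurableTypeR R) -> \bar R} :=
  measure_function_pushforward__canonical__measure_function_Measure
    (@lebesgue_measure R) mc.
rewrite [RHS](@lebesgue_measure_unique R (mscale k mc'))//.
move=> _ [[a b] _ <-] /=; rewrite /mscale /= /pushforward.
have -> : (fun x => c * x)%R @^-1` `]a, b]%classic = `](a / c)%R, (b / c)%R]%classic.
  apply/seteqP; split => x /=; rewrite !in_itv/= ltr_pdivrMr// ler_pdivlMr//.
    by rewrite ![(c * x)%R]mulrC.
  by rewrite ![(c * x)%R]mulrC.
rewrite !lebesgue_measure_itv/= !lte_fin ltr_pM2r ?invr_gt0//.
case: ifPn => _; last by rewrite mule0.
rewrite -!EFinB -EFinM; congr (_%:E).
by rewrite -mulrBl mulrC divfK// gt_eqF.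
Qed.

Lemma ge0_integral_scale (R : realType) (c : R) (f : R -> \bar R) :
  (0 < c)%R -> measurable_fun setT f -> (forall x, 0 <= f x) ->
  \int[lebesgue_measure]_x f x =
  \int[lebesgue_measure]_x (c%:E * f (c * x)%R).
Proof.
move=> c0 mf f0.
have mc : @measurable_fun _ _ R R setT (fun x : R => c * x)%R.
  by apply: measurable_funM.
apply: (@ge0_integral_density _ _ _ _ R lebesgue_measure lebesgue_measure
  (fun x => c * x)%R (cst c) setT) => //.
  by move=> *; exact: ltW.
move=> B mB; rewrite setTI (integral_cst _ _ c%:E)//; last first.
  by rewrite -[X in measurable X]setTI; exact: (mc).
by rewrite lebesgue_measure_scale.
Qed.

End Integration.

(** * Evaluation of an integer-valued process at an independent random time *)

Lemma measurable_fun_nat d (T : measurableType d) (J : T -> nat) :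
  (forall j, measurable (J @^-1` [set j])) -> measurable_fun setT J.
Proof.
move=> mJ _ B _; rewrite setTI.
have -> : J @^-1` B = \bigcup_(j in B) J @^-1` [set j].
  by apply/seteqP; split => [w Bw|w [j Bj /= ->]//]; exists (J w).
exact: bigcup_measurable.
Qed.

(** Turns convergence of integer-valued paths into eventual equality. *)
Lemma natr_dist_lt1 (R : realDomainType) (m n : nat) :
  `|m%:R - n%:R : R| < 1 -> m = n.
Proof.
rewrite ltr_norml ltrNl opprB !ltrBlDl !natr1 !ltr_nat !ltnS => /andP[nm mn].
by apply/eqP; rewrite eqn_leq nm mn.
Qed.

Section Random_time.
Context d (T : measurableType d) (R : realType) (P : probability T R).

(* These discrete times tend to [Y] from strictly above, so that
   right-continuity of the paths suffices. *)
Let approx (Y : T -> R) n w : R :=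
  (Num.trunc (n.+1%:R * Y w)).+1%:R / n.+1%:R.

Let approx_gt Y n w : Y w < approx Y n w.
Proof. by rewrite ltr_pdivlMr// mulrC truncnS_gt. Qed.

Let cvg_approx Y w : 0 <= Y w -> approx Y n w @[n --> \oo] --> Y w.
Proof.
move=> Y0; apply: (@squeeze_cvgr _ _ _ _ (cst (Y w)) (fun n => Y w + harmonic n)).
- near=> n; rewrite (ltW (approx_gt _ _ _))/=.
  rewrite ler_pdivrMr// mulrDl /harmonic/= mulVf// -natr1 lerD2r mulrC.
  by rewrite truncn_le mulr_ge0.
- exact: cvg_cst.
- rewrite -[X in _ --> X]addr0; apply: cvgD; first exact: cvg_cst.
  exact: cvg_harmonic.
Unshelve. all: by end_near. Qed.

(** For the discretised times the identity is a countable sum of independence relations. Dominated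
    convergence then passes to the limit, by right-continuity of the paths on the left and by
    continuity of [q] on the right. *)
Lemma prob_random_time (N : R -> T -> nat) (Y : T -> R) (q : R -> R) (k : nat) :
  measurable_fun setT Y -> (forall w, 0 <= Y w) ->
  (forall s, 0 <= s -> measurable (N s @^-1` [set k])) ->
  (forall w t, 0 <= t -> (N s w)%:R @[s --> t^'+] --> ((N t w)%:R : R)) ->
  (forall s, 0 <= s -> P (N s @^-1` [set k]) = (q s)%:E) ->
  (forall s B, 0 <= s -> measurable B ->
    (P (N s @^-1` [set k] `&` Y @^-1` B) =
     P (N s @^-1` [set k]) * P (Y @^-1` B))%E) ->
  continuous q ->
  P [set w | N (Y w) w = k] = (\int[P]_w (q (Y w))%:E)%E.
Proof.
move=> mY Y0 mN rcN qE indep cq.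
pose J n w := Num.trunc (n.+1%:R * Y w).
pose y n (j : nat) : R := j.+1%:R / n.+1%:R.
have y0 n j : 0 <= y n j by rewrite divr_ge0.
have q0 s : 0 <= s -> 0 <= q s by move=> s0; rewrite -lee_fin -qE.
have q1 s : 0 <= s -> q s <= 1.
  by move=> s0; rewrite -lee_fin -qE// probability_le1//; exact: mN.
pose I n j : set R := `[j%:R / n.+1%:R, j.+1%:R / n.+1%:R[%classic.
have mI n j : measurable (I n j) by exact: measurable_itv.
have JE n j : J n @^-1` [set j] = Y @^-1` I n j.
  have YI w : (J n w == j) = (Y w \in `[j%:R / n.+1%:R, j.+1%:R / n.+1%:R[).
    by rewrite truncn_eq ?mulr_ge0// in_itv/= ler_pdivrMr// ltr_pdivlMr// mulrC.
  by apply/seteqP; split => w; rewrite /= /I/= -YI => /eqP.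
have mJ n j : measurable (J n @^-1` [set j]).
  by rewrite JE -[X in measurable X]setTI; exact: (mY).
pose A n := [set w | N (approx Y n w) w = k].
have mA n : measurable (A n).
  have -> : A n = \bigcup_j (J n @^-1` [set j] `&` N (y n j) @^-1` [set k]).
    apply/seteqP; split => [w Aw|w [j _ [/= <-]]//].
    by exists (J n w).
  by apply: bigcupT_measurable => j; apply: measurableI => //; exact: mN.
(* On [J n = j] the time is the constant [y n j], and that event says only that [Y] lies in [I n j],
   so independence applies cell by cell. *)
have stepE n : (\int[P]_w (\1_(A n) w)%:E = \int[P]_w (q (approx Y n w))%:E)%E.
  pose f j w : \bar R := (\1_(N (y n j) @^-1` [set k]) w)%:E.
  pose g j (w : T) : \bar R := (q (y n j))%:E.
  transitivity (\int[P]_w f (J n w) w)%E; first by apply: eq_integral.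
  transitivity (\int[P]_w g (J n w) w)%E; last by apply: eq_integral.
  rewrite !ge0_integral_nat_partition//.
  - apply: eq_eseriesr => j _.
    rewrite integral_indic//; last exact: mN.
    rewrite (integral_cst P _ (q (y n j))%:E)//.
    by rewrite JE -(qE _ (y0 n j)); exact: indep.
  - by move=> j; apply/measurable_EFinP; exact: measurable_cst.
  - by move=> j w; rewrite /g lee_fin q0.
  - by move=> j; apply/measurable_EFinP/measurable_indic; exact: mN.
  - by move=> j w; rewrite /f lee_fin.
have int1 : P.-integrable setT (EFin \o cst 1).
  exact: finite_measure_integrable_cst.
have m_approx n : measurable_fun setT (approx Y n).
  apply: (@measurableT_comp _ _ _ _ _ _ (y n) _ (J n)) => //.
  exact: measurable_fun_nat.
(* The values are integers, so convergence along the path makes the indicator eventually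
   constant. *)
have cvgA w : \1_(A n) w @[n --> \oo] --> (\1_[set w | N (Y w) w = k] w : R).
  have /cvg_at_rightP/(_ (fun n => approx Y n w)) := rcN w _ (Y0 w).
  move=> /(_ (conj (fun n => approx_gt Y n w) (cvg_approx (Y0 w)))).
  move=> /cvgrPdist_lt/(_ 1 ltr01) near1.
  apply: cvg_near_cst; near=> n.
  have NE : N (approx Y n w) w = N (Y w) w.
    have : `|((N (Y w) w)%:R : R) - (N (approx Y n w) w)%:R| < 1 by near: n.
    by rewrite distrC => /natr_dist_lt1.
  by rewrite !indicE; congr (_%:R); congr nat_of_bool;
    apply/idP/idP => /set_mem/= NA; apply/mem_set; rewrite /A/= ?NE// -NE.
(* Measurability of the limit event is itself a consequence of the approximation. *)
have mlim : measurable_fun setT (\1_[set w | N (Y w) w = k] : T -> R).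
  by apply: (@measurable_fun_cvg _ _ _ setT (fun n => \1_(A n))).
have mL : measurable [set w | N (Y w) w = k].
  have -> : [set w | N (Y w) w = k] =
      (\1_[set w | N (Y w) w = k] : T -> R) @^-1` [set 1].
    apply/seteqP; split => w Lw; first by rewrite /= indicE mem_set.
    by move: Lw; rewrite /= indicE; case: (boolP (_ \in _)) => [/set_mem//|_ /eqP];
      rewrite eq_sym oner_eq0.
  by rewrite -[X in measurable X]setTI; exact: mlim.
have mq : measurable_fun setT q by exact: continuous_measurable_fun.
have cvgL : (\int[P]_w (\1_(A n) w)%:E)%E @[n --> \oo] --> P [set w | N (Y w) w = k].
  rewrite -[X in P X]setIT -integral_indic//.
  apply: (dominated_cvg _ _ _ _ int1) => //=.
  - by move=> n; apply/measurable_EFinP/measurable_indic.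
  - by move=> w _; apply: cvg_EFin; [exact: nearW|exact: cvgA].
  - by move=> n w _; rewrite lee_fin indicE; case: (_ \in _); rewrite ?normr1 ?normr0.
have cvgR : (\int[P]_w (q (approx Y n w))%:E)%E @[n --> \oo] -->
    (\int[P]_w (q (Y w))%:E)%E.
  apply: (dominated_cvg _ _ _ _ int1) => //=.
  - by move=> n; apply/measurable_EFinP; exact: measurableT_comp.
  - move=> w _; apply: cvg_EFin; first exact: nearW.
    by apply: continuous_cvg; [exact: cq|exact: cvg_approx].
  - move=> n w _; have a0 : 0 <= approx Y n w by rewrite (le_trans (Y0 w))// ltW// approx_gt.
    by rewrite lee_fin ger0_norm ?q0 ?q1.
rewrite (funext stepE : (fun n => \int[P]_w (\1_(A n) w)%:E)%E = _) in cvgL.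
by apply: cvg_unique cvgL cvgR.
Unshelve. all: by end_near. Qed.

End Random_time.

(** One-sided quotients occur twice: in the recurrence for [Gamma], and at time 0, where the
    processes are constrained only to the right. *)
Lemma is_derive_cvg_right (R : realType) (f : R -> R) (x df : R) :
  is_derive x (1 : R) f df -> h^-1 * (f (x + h) - f x) @[h --> 0^'+] --> df.
Proof.
move=> dfx; have -> : df = 'D_1 f x by rewrite derive_val.
apply: cvg_dnbhs_at_right; have := @ex_derive _ _ _ _ _ _ _ dfx.
rewrite /derivable /derive => dcvg; apply: cvg_trans dcvg.
by apply: near_eq_cvg; near=> h; rewrite /= scaler1 [h + x]addrC.
Unshelve. all: by end_near. Qed.

(** * The Gamma integral: scaling, finiteness and recurrence *)

Section Gamma_function.
Context {R : realType}.
Implicit Types a b c h l x : R.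

(** The rate [c] stays free: a Poisson weight shifts it, and the recurrence comes from varying it
    near 1. *)
Definition gamma_kernel a c x : R := x `^ (a - 1) * expR (- (c * x)).

(* [Gamma] is a [fine] of an extended integral: this says that it is no junk. *)
Definition Gamma_converges a : Prop :=
  (\int[lebesgue_measure]_(x in `]0%R, +oo[) (gamma_kernel a 1 x)%:E =
   (Gamma a)%:E)%E.

Lemma gamma_kernel_ge0 a c x : 0 <= gamma_kernel a c x.
Proof. by rewrite mulr_ge0 ?powR_ge0 ?expR_ge0. Qed.

Lemma measurable_gamma_kernel a c : measurable_fun setT (gamma_kernel a c).
Proof.
apply: measurable_funM; first exact: measurable_powR.
by apply: measurableT_comp => //; apply: measurableT_comp.
Qed.

Lemma gamma_kernel_exp a c x (k : nat) : 0 < x ->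
  gamma_kernel (a + k%:R) c x = x ^+ k * gamma_kernel a c x.
Proof.
move=> x0; rewrite /gamma_kernel mulrA; congr (_ * _).
rewrite addrAC [LHS]powRD ?(gt_eqF x0) ?implybT//.
by rewrite powR_mulrn ?ltW// mulrC.
Qed.

(** Substitution of [c * x] for [x]. Stated in the extended reals, it holds before finiteness is
    known and so carries finiteness from rate [c] to rate 1. *)
Lemma integral_gamma_kernel_scale a c : 0 < c ->
  ((c `^ a)%:E * \int[lebesgue_measure]_(x in `]0%R, +oo[) (gamma_kernel a c x)%:E =
   \int[lebesgue_measure]_(x in `]0%R, +oo[) (gamma_kernel a 1 x)%:E)%E.
Proof.
move=> c0.
have mK (e : R) : measurable_fun setT (EFin \o gamma_kernel a e).
  by apply/measurable_EFinP; exact: measurable_gamma_kernel.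
have m0oo : measurable (`]0, +oo[%classic : set R) by exact: (@measurable_itv R).
rewrite [RHS]integral_mkcond (ge0_integral_scale c0); last 2 first.
- apply/(measurable_restrictT (EFin \o gamma_kernel a 1) m0oo).
  apply: measurable_funTS; exact: mK.
- by move=> x; rewrite patchE; case: ifPn => // _; rewrite lee_fin gamma_kernel_ge0.
rewrite -ge0_integralZl//; last 3 first.
- apply: measurable_funTS; exact: mK.
- by move=> x _; rewrite lee_fin gamma_kernel_ge0.
- by rewrite lee_fin powR_ge0.
rewrite integral_mkcond; apply: eq_integral => x _; rewrite !patchE.
have -> : (c * x \in `]0, +oo[%classic) = (x \in `]0, +oo[%classic).
  by apply/idP/idP; rewrite !inE/= !in_itv/= !andbT pmulr_rgt0.
case: ifPn => [|_]; last by rewrite mule0.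
rewrite inE/= in_itv/= andbT => x0.
have ca : c `^ a = c * c `^ (a - 1).
  by rewrite -[X in X * _](powRr1 (ltW c0)) -powRD ?(gt_eqF c0) ?implybT// subrKC.
by rewrite -!EFinM /gamma_kernel mul1r powRM ?ltW// ca !mulrA.
Qed.

Lemma integral_gamma_kernel a c : Gamma_converges a -> 0 < c ->
  (\int[lebesgue_measure]_(x in `]0%R, +oo[) (gamma_kernel a c x)%:E =
   (Gamma a / c `^ a)%:E)%E.
Proof.
move=> Ga c0; have ca0 : 0 < c `^ a by rewrite powR_gt0.
have := integral_gamma_kernel_scale a c0; rewrite Ga.
move=> /(congr1 (fun y => ((c `^ a)^-1)%:E * y)%E).
by rewrite muleA -!EFinM mulVf ?gt_eqF// mul1e mulrC.
Qed.

Lemma Gamma_ge0 a : 0 <= Gamma a.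
Proof.
rewrite /Gamma /Rintegral fine_ge0//; apply: integral_ge0 => x _.
by rewrite lee_fin mulr_ge0 ?powR_ge0 ?expR_ge0.
Qed.

Lemma Gamma_kernelE a : Gamma a =
  fine (\int[lebesgue_measure]_(x in `]0%R, +oo[) (gamma_kernel a 1 x)%:E)%E.
Proof.
congr fine; apply: eq_integral => x _.
by rewrite /gamma_kernel mul1r.
Qed.

Lemma gamma_pdfE a c x :
  gamma_pdf a c x = c `^ a / Gamma a * gamma_kernel a c x.
Proof. by rewrite /gamma_pdf /gamma_kernel mulNr mulrA. Qed.

Lemma gamma_pdf_ge0 a c x : 0 <= gamma_pdf a c x.
Proof.
by rewrite gamma_pdfE !mulr_ge0 ?powR_ge0 ?invr_ge0 ?Gamma_ge0 ?expR_ge0.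
Qed.

(* Were the Gamma integral infinite, [Gamma a] would be the junk value 0 and the
   density would vanish. *)
Lemma Gamma_total_mass a c : 0 < c ->
  (\int[lebesgue_measure]_(x in `]0%R, +oo[) (gamma_pdf a c x)%:E = 1)%E ->
  Gamma_converges a /\ 0 < Gamma a.
Proof.
move=> c0.
have m0oo : measurable (`]0, +oo[%classic : set R) by exact: (@measurable_itv R).
under eq_integral do rewrite gamma_pdfE EFinM.
rewrite ge0_integralZl//; last 3 first.
- by apply/measurable_EFinP/measurable_funTS; exact: measurable_gamma_kernel.
- by move=> x _; rewrite lee_fin gamma_kernel_ge0.
- by rewrite lee_fin divr_ge0 ?powR_ge0 ?Gamma_ge0.
have [G0|G0] := eqVneq (Gamma a) 0.
  by rewrite G0 invr0 mulr0 mul0e => /eqP; rewrite eqe eq_sym oner_eq0.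
move=> I1; split; last by rewrite lt_def G0 Gamma_ge0.
have I0 : (0 <= \int[lebesgue_measure]_(x in `]0%R, +oo[) (gamma_kernel a c x)%:E)%E.
  by apply: integral_ge0 => x _; rewrite lee_fin gamma_kernel_ge0.
rewrite /Gamma_converges Gamma_kernelE fineK//.
rewrite -(integral_gamma_kernel_scale a c0).
(* Only the value [+oo] remains: times a positive constant it cannot be 1. *)
move: I1 I0; case: (\int[_]_(x in _) _)%E => [r|//|//] //.
rewrite gt0_muley// lte_fin divr_gt0 ?powR_gt0// lt_def G0 Gamma_ge0//.
Qed.

(* Integrating [1 - h x <= expR (- (h x))] and [1 + h x <= expR (h x)] against the
   kernel traps [Gamma (a + 1)] between difference quotients of
   [Gamma a / c `^ a] at [c = 1], without any boundary term. *)
Lemma Gamma_recurrence_upper a h : 0 < h -> Gamma_converges a ->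
  Gamma_converges (a + 1) ->
  Gamma a <= Gamma a / (1 + h) `^ a + h * Gamma (a + 1).
Proof.
move=> h0 Ga Ga1; have h1 : 0 < 1 + h by rewrite addr_gt0.
have mK (b e : R) : measurable_fun (`]0%R, +oo[%classic : set R) (fun x => (gamma_kernel b e x)%:E).
  by apply/measurable_EFinP/measurable_funTS; exact: measurable_gamma_kernel.
have K0 (b e x : R) : (0 <= (gamma_kernel b e x)%:E)%E.
  by rewrite lee_fin gamma_kernel_ge0.
have m0oo : measurable (`]0, +oo[%classic : set R) by exact: (@measurable_itv R).
rewrite -lee_fin EFinD -(integral_gamma_kernel Ga h1) EFinM -Ga -Ga1.
have mhK b e : measurable_fun (`]0, +oo[%classic : set R)
    (fun x => h%:E * (gamma_kernel b e x)%:E)%E.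
  by apply: emeasurable_funM => //; exact: mK.
have hK0 b e x : (0 <= h%:E * (gamma_kernel b e x)%:E)%E.
  by rewrite mule_ge0// lee_fin ltW.
rewrite -ge0_integralZl ?lee_fin ?(ltW h0)//; last exact: mK.
rewrite -ge0_integralD//; last 2 first.
- exact: mK.
- exact: mhK.
apply: ge0_le_integral => //.
- exact: mK.
- by apply: emeasurable_funD; [exact: mK|exact: mhK].
- move=> x /=; rewrite in_itv/= andbT => x0.
  rewrite -EFinM -EFinD lee_fin (gamma_kernel_exp a 1 1)// expr1.
  rewrite /gamma_kernel mul1r mulrDl mul1r opprD expRD.
  set p := x `^ _; set e := expR (- x); set f := expR _.
  rewrite [leRHS](_ : _ = p * e * (f + h * x)); last by ring.
  rewrite ler_peMr ?mulr_ge0 ?powR_ge0 ?expR_ge0//.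
  by have := expR_ge1Dx (- (h * x)); rewrite /f; lra.
Qed.

(** Pointwise this is [(1 + h x) * expR (- (h x)) <= 1]. Here the term of shape [a + 1] has rate
    [1 + h], whence its denominator, which tends to 1 with [h]. *)
Lemma Gamma_recurrence_lower a h : 0 < h -> Gamma_converges a ->
  Gamma_converges (a + 1) ->
  Gamma a / (1 + h) `^ a + h * (Gamma (a + 1) / (1 + h) `^ (a + 1)) <= Gamma a.
Proof.
move=> h0 Ga Ga1; have h1 : 0 < 1 + h by rewrite addr_gt0.
have mK (b e : R) : measurable_fun (`]0%R, +oo[%classic : set R) (fun x => (gamma_kernel b e x)%:E).
  by apply/measurable_EFinP/measurable_funTS; exact: measurable_gamma_kernel.
have K0 (b e x : R) : (0 <= (gamma_kernel b e x)%:E)%E.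
  by rewrite lee_fin gamma_kernel_ge0.
have m0oo : measurable (`]0, +oo[%classic : set R) by exact: (@measurable_itv R).
rewrite -lee_fin EFinD -(integral_gamma_kernel Ga h1) EFinM.
rewrite -(integral_gamma_kernel Ga1 h1) -Ga.
have mhK b e : measurable_fun (`]0, +oo[%classic : set R)
    (fun x => h%:E * (gamma_kernel b e x)%:E)%E.
  by apply: emeasurable_funM => //; exact: mK.
have hK0 b e x : (0 <= h%:E * (gamma_kernel b e x)%:E)%E.
  by rewrite mule_ge0// lee_fin ltW.
rewrite -ge0_integralZl ?lee_fin ?(ltW h0)//; last exact: mK.
rewrite -ge0_integralD//; last 2 first.
- exact: mK.
- exact: mhK.
apply: ge0_le_integral => //.
- by move=> x _; rewrite adde_ge0.
- by apply: emeasurable_funD; [exact: mK|exact: mhK].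
- exact: mK.
- move=> x /=; rewrite in_itv/= andbT => x0.
  rewrite -EFinM -EFinD lee_fin (gamma_kernel_exp a (1 + h) 1)// expr1.
  rewrite /gamma_kernel mul1r mulrDl mul1r opprD expRD.
  set p := x `^ _; set e := expR (- x); set f := expR _.
  rewrite [leLHS](_ : _ = p * e * (f * (1 + h * x))); last by ring.
  rewrite ler_piMr ?mulr_ge0 ?powR_ge0 ?expR_ge0//.
  rewrite /f expRN ler_pdivrMl ?expR_gt0// mulr1.
  exact: expR_ge1Dx.
Qed.

(** The right quotient at 1 of [- Gamma a / c ^ a], as a function of [c], tends to [a * Gamma a] by
    differentiation and to [Gamma (a + 1)] by squeezing between the two bounds. *)
Lemma Gamma_recurrence a : Gamma_converges a -> Gamma_converges (a + 1) ->
  Gamma (a + 1) = a * Gamma a.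
Proof.
move=> Ga Ga1.
pose phi (y : R) := y `^ (- a).
have lim1 : h^-1 * (Gamma a - Gamma a * phi (1 + h)) @[h --> (0 : R)^'+] -->
    a * Gamma a.
  have /is_derive_cvg_right : is_derive (1 : R) (1 : R) phi (- a * 1 `^ (- a - 1)).
    exact: is_derive1_powR.
  rewrite powR1 mulr1 => dphi.
  have -> : a * Gamma a = - a * - Gamma a by ring.
  have -> : (fun h => h^-1 * (Gamma a - Gamma a * phi (1 + h))) =
      (fun h => h^-1 * (phi (1 + h) - phi 1) * - Gamma a).
    by apply/funext => h; rewrite /phi powR1; ring.
  by apply: cvgM => //; exact: cvg_cst.
have lim2 : h^-1 * (Gamma a - Gamma a * phi (1 + h)) @[h --> (0 : R)^'+] -->
    Gamma (a + 1).
  apply: (@squeeze_cvgr _ _ _ _ (fun h => Gamma (a + 1) / (1 + h) `^ (a + 1))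
    (cst (Gamma (a + 1)))).
  - near=> h.
    have h0 : 0 < h by [].
    rewrite /phi powRN ler_pdivlMl// ler_pdivrMl//.
    have := Gamma_recurrence_lower h0 Ga Ga1.
    by have := Gamma_recurrence_upper h0 Ga Ga1; rewrite /cst; lra.
  - suff : Gamma (a + 1) / (1 + h) `^ (a + 1) @[h --> (0 : R)^'+] -->
        Gamma (a + 1) / (1 + 0) `^ (a + 1) by rewrite addr0 powR1 divr1.
    apply: cvgM; first exact: cvg_cst.
    apply: cvgV; first by rewrite addr0 powR1 oner_neq0.
    apply: cvg_at_right_filter.
    apply: (@continuous_comp _ _ _ (fun h : R => 1 + h) (fun y => y `^ (a + 1))).
      by apply: cvgD; [exact: cvg_cst|exact: cvg_id].
    apply/differentiable_continuous/derivable1_diffP.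
    rewrite addr0; apply: (@ex_derive _ _ _ _ _ _ _ (is_derive1_powR _ ltr01)).
  - exact: cvg_cst.
by apply/esym; exact: cvg_unique lim1 lim2.
Unshelve. all: by end_near. Qed.

End Gamma_function.

(** * Rising factorials and Vandermonde's identity *)

Section Rising_factorial.
Context {R : realType}.
Implicit Types a b l : R.

(** The Pochhammer symbol, standing for [Gamma (a + k) / Gamma a]; as a product it also makes sense
    at [a = 0]. *)
Definition rising_factorial a (k : nat) : R := \prod_(i < k) (a + i%:R).

Lemma rising_factorialS a k :
  rising_factorial a k.+1 = rising_factorial a k * (a + k%:R).
Proof. by rewrite /rising_factorial big_ord_recr. Qed.

Lemma rising_factorial0l k : rising_factorial 0 k = (k == 0%N)%:R.
Proof.
case: k => [|k]; first by rewrite /rising_factorial big_ord0.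
by rewrite /rising_factorial big_ord_recl addr0 mul0r.
Qed.

Lemma rising_factorial_ge0 a k : 0 <= a -> 0 <= rising_factorial a k.
Proof. by move=> a0; apply: prodr_ge0 => i _; rewrite addr_ge0. Qed.

(* Multiply the sum by [k + 1 = m + (k + 1 - m)]: both halves fold back to the
   sum for [k], with factors adding up to [a + b + k]. *)
Lemma rising_factorial_Vandermonde a b k :
  \sum_(m < k.+1) rising_factorial a m / m`!%:R *
    (rising_factorial b (k - m) / (k - m)`!%:R) =
  rising_factorial (a + b) k / k`!%:R.
Proof.
pose u a k : R := rising_factorial a k / k`!%:R.
have uS x j : j.+1%:R * u x j.+1 = (x + j%:R) * u x j.
  rewrite /u rising_factorialS factS natrM; field.
  by rewrite nat1r !pnatr_eq0 -lt0n fact_gt0.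
rewrite -[RHS]/(u (a + b) k) -[LHS]/(\sum_(m < k.+1) u a m * u b (k - m)%N).
elim: k => [|k IH].
  by rewrite big_ord1 /u /rising_factorial !big_ord0 !divr1 mulr1.
have k1 : k.+1%:R != 0 :> R by rewrite pnatr_eq0.
apply: (mulfI k1); rewrite uS -IH.
transitivity (\sum_(m < k.+2) m%:R * u a m * u b (k.+1 - m)%N +
    \sum_(m < k.+2) u a m * ((k.+1 - m)%:R * u b (k.+1 - m)%N)).
  rewrite mulr_sumr -big_split; apply: eq_bigr => m _ /=.
  rewrite natrB; last by rewrite -ltnS.
  by ring.
(* The first sum loses its term [m = 0] and is shifted, the second loses its term [m = k + 1]; both
   now run over [m <= k]. *)
rewrite [X in X + _]big_ord_recl mul0r mul0r add0r.
rewrite [X in _ + X]big_ord_recr/= subnn mul0r mulr0 addr0.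
rewrite -big_split mulr_sumr; apply: eq_bigr => m _ /=.
rewrite subSS subSn; last by rewrite -ltnS.
rewrite !uS natrB; last by rewrite -ltnS.
by ring.
Qed.

End Rising_factorial.

(** * Negative binomial weights and their convolution *)

Section Negative_binomial.
Context {R : realType}.
Implicit Types a b l : R.

(** The law of a Poisson variable whose parameter is [l] times a Gamma variable of shape [a] and
    rate [b]. At [a = 0] it is the point mass at 0, which matches the Gamma process at time 0. *)
Definition negbin_pmf l b a (k : nat) : R :=
  (b / (l + b)) `^ a * (l / (l + b)) ^+ k * (rising_factorial a k / k`!%:R).

Lemma negbin_pmf0 l b k : negbin_pmf l b 0 k = (k == 0%N)%:R.
Proof.
rewrite /negbin_pmf rising_factorial0l powRr0 mul1r.
by case: k => [|k]; rewrite ?mul0r ?mulr0// expr0 divr1 mulr1.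
Qed.

Lemma negbin_pmf_ge0 l b a k : 0 <= l -> 0 <= b -> 0 <= a ->
  0 <= negbin_pmf l b a k.
Proof.
move=> l0 b0 a0; rewrite /negbin_pmf !mulr_ge0 ?powR_ge0 ?invr_ge0//.
  by rewrite exprn_ge0// divr_ge0// addr_ge0.
exact: rising_factorial_ge0.
Qed.

(** The powers of both ratios split multiplicatively, which leaves Vandermonde's identity. *)
Lemma negbin_pmf_conv l b a1 a2 k : 0 < l -> 0 < b ->
  negbin_pmf l b (a1 + a2) k =
  \sum_(m < k.+1) negbin_pmf l b a1 m * negbin_pmf l b a2 (k - m).
Proof.
move=> l0 b0.
rewrite /negbin_pmf -rising_factorial_Vandermonde mulr_sumr.
apply: eq_bigr => m _.
have r0 : 0 < b / (l + b) by rewrite divr_gt0// addr_gt0.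
rewrite powRD ?(gt_eqF r0) ?implybT//.
have -> : (l / (l + b)) ^+ k = (l / (l + b)) ^+ m * (l / (l + b)) ^+ (k - m).
  by rewrite -exprD subnKC// -ltnS.
by ring.
Qed.

End Negative_binomial.

(** * Exponential generating functions with bounded coefficients *)

Section Exponential_series.
Context {R : realType}.
Implicit Types (c : nat -> R) (x : R).

Definition exp_series c x : R := limn (pseries (fun i => c i / i`!%:R) x).

Lemma is_cvg_exp_series c x : (forall n, `|c n| <= 1) ->
  cvgn (pseries (fun i => c i / i`!%:R) x).
Proof.
move=> c1; apply: normed_cvg.
apply: (@series_le_cvg _ _ (exp_coeff `|x|)) => /=.
- by move=> n; exact: normr_ge0.
- by move=> n; rewrite exp_coeff_ge0.
- move=> n; rewrite !normrM normrX exp_coeffE ler_wpM2r ?exprn_ge0//.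
  by rewrite normfV (ger0_norm (ler0n _ _))// ler_piMl ?invr_ge0.
- exact: is_cvg_series_exp_coeff.
Qed.

(** Termwise differentiation cancels one factor of the factorial and so shifts the coefficients,
    which keep the bound 1. *)
Lemma is_derive_exp_series c x : (forall n, `|c n| <= 1) ->
  is_derive x (1 : R) (exp_series c) (exp_series (fun n => c n.+1) x).
Proof.
move=> c1.
have diffE (e : nat -> R) :
    pseries_diffs (fun i => e i / i`!%:R) = (fun i => e i.+1 / i`!%:R).
  apply/funext => i; rewrite /pseries_diffs factS natrM; field.
  by rewrite nat1r !pnatr_eq0 -lt0n fact_gt0.
(* The series and its first two formal derivatives must converge at some point of modulus beyond
   that of [x]; any would do. *)
rewrite /exp_series -diffE; apply: (@pseries_snd_diffs _ _ (`|x| + 1)).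
- exact: is_cvg_exp_series.
- by rewrite diffE; exact: (is_cvg_exp_series (c := fun n => c n.+1)).
- by rewrite !diffE; exact: (is_cvg_exp_series (c := fun n => c n.+2)).
- by rewrite [ltRHS]ger0_norm ?addr_ge0// ltrDl.
Qed.

Lemma exp_series_sum (k : nat) (u : 'I_k -> R) (c : 'I_k -> nat -> R) x :
  (forall m n, `|c m n| <= 1) ->
  exp_series (fun n => \sum_(m < k) u m * c m n) x =
  \sum_(m < k) u m * exp_series (c m) x.
Proof.
move=> c1; apply/cvg_lim => //.
have -> : pseries (fun i => (\sum_(m < k) u m * c m i) / i`!%:R) x =
    (fun n => \sum_(m < k) u m * pseries (fun i => c m i / i`!%:R) x n).
  apply/funext => n; rewrite /pseries /series/=.
  under [RHS]eq_bigr do rewrite mulr_sumr.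
  rewrite exchange_big; apply: eq_bigr => i _ /=.
  by rewrite !mulr_suml; apply: eq_bigr => m _; ring.
apply: (cvg_big add_continuous) => m _; apply: cvgM; first exact: cvg_cst.
exact: is_cvg_exp_series.
Qed.

Lemma exp_series_geometric (r : R) x :
  exp_series (fun n => r ^+ n) x = expR (r * x).
Proof.
rewrite expRE /exp_series /pseries/=; congr (limn (series _)).
by apply/funext => n; rewrite exprMn; ring.
Qed.

End Exponential_series.

Lemma powR_div (R : realType) (x y r : R) : 0 <= x -> 0 <= y ->
  (x / y) `^ r = x `^ r / y `^ r.
Proof.
move=> x0 y0; rewrite powRM ?invr_ge0//; congr (_ * _).
by rewrite -powR_inv1// -powRrM mulN1r powRN.
Qed.

(** * Poisson weights and their integral against a Gamma density *)

Section Poisson_weight.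
Context {R : realType}.
Implicit Types l b a t : R.

(* Unlike [poisson_pmf], this has the right value at rate 0. *)
Definition poisson_weight l (k : nat) t : R :=
  (l * t) ^+ k / k`!%:R * expR (- (l * t)).

Lemma poisson_weight0 l k : poisson_weight l k 0 = (k == 0%N)%:R.
Proof.
rewrite /poisson_weight mulr0 oppr0 expR0 mulr1.
by case: k => [|k]; rewrite ?expr0 ?divr1// expr0n mul0r.
Qed.

Lemma continuous_poisson_weight l k : continuous (poisson_weight l k).
Proof.
move=> t; apply: cvgM.
  apply: cvgM; last exact: cvg_cst.
  by apply: (@continuous_comp _ _ _ (fun t => l * t) (fun x => x ^+ k));
    [apply: cvgM; [exact: cvg_cst|exact: cvg_id]|exact: exprn_continuous].
apply: (@continuous_comp _ _ _ (fun t => - (l * t)) expR); last exact: continuous_expR.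
by apply: cvgN; apply: cvgM; [exact: cvg_cst|exact: cvg_id].
Qed.

(** The weight contributes [x ^ k] and [expR (- (l * x))], so the integrand is a constant times the
    kernel of shape [a + k] and rate [l + b]. *)
Lemma integral_gamma_pdf_poisson_weight l b a k : 0 < l -> 0 < b ->
  Gamma_converges (a + k%:R) -> Gamma a != 0 ->
  Gamma (a + k%:R) = rising_factorial a k * Gamma a ->
  (\int[lebesgue_measure]_(x in `]0%R, +oo[)
     ((gamma_pdf a b x)%:E * (poisson_weight l k x)%:E) =
   (negbin_pmf l b a k)%:E)%E.
Proof.
move=> l0 b0 Gak Ga0 GE.
have lb0 : 0 < l + b by rewrite addr_gt0.
pose K := b `^ a / Gamma a * (l ^+ k / k`!%:R).
transitivity (\int[lebesgue_measure]_(x in `]0%R, +oo[)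
    (K%:E * (gamma_kernel (a + k%:R) (l + b) x)%:E))%E.
  apply: eq_integral => x; rewrite inE/= in_itv/= andbT => x0.
  rewrite -!EFinM gamma_pdfE gamma_kernel_exp// /poisson_weight /gamma_kernel /K.
  rewrite mulrDl opprD expRD exprMn; congr (_%:E); ring.
rewrite ge0_integralZl//; last 3 first.
- by apply/measurable_EFinP/measurable_funTS; exact: measurable_gamma_kernel.
- by move=> x _; rewrite lee_fin gamma_kernel_ge0.
- rewrite lee_fin !mulr_ge0 ?powR_ge0 ?invr_ge0 ?Gamma_ge0//.
  by rewrite exprn_ge0 ?ltW.
rewrite integral_gamma_kernel// -EFinM GE /K /negbin_pmf; congr (_%:E).
rewrite powRD ?(gt_eqF lb0) ?implybT// powR_mulrn ?ltW// expr_div_n.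
rewrite powR_div ?ltW//.
field.
by rewrite Ga0 pnatr_eq0 -lt0n fact_gt0 expf_neq0 ?(gt_eqF (powR_gt0 _ _)) ?gt_eqF.
Qed.

End Poisson_weight.

(** * Marginal laws of the Poisson, Gamma and compound processes *)

Section Processes.
Context d (T : measurableType d) (R : realType) (P : probability T R).
Implicit Types l b t : R.

Lemma measurable_poisson_process l (N : R -> T -> nat) t k :
  poisson_process P l N -> 0 <= t -> measurable (N t @^-1` [set k]).
Proof.
move=> [LN _] t0.
have -> : N t @^-1` [set k] = (fun w => (N t w)%:R : R) @^-1` [set k%:R].
  by apply/seteqP; split => w /= => [->//|/eqP]; rewrite eqr_nat => /eqP.
rewrite -[X in measurable X]setTI.
by apply: (levy_measurable LN) => //.
Qed.

Lemma poisson_process_prob l (N : R -> T -> nat) t k : 0 < l ->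
  poisson_process P l N -> 0 <= t ->
  P (N t @^-1` [set k]) = (poisson_weight l k t)%:E.
Proof.
move=> l0 [LN NE]; rewrite le_eqVlt => /predU1P[<-|t0]; last first.
  rewrite (NE _ _ t0) /poisson_pmf mulr_gt0//.
(* At time 0 the law comes from the start of the paths, since the marginals are prescribed only for
   positive times. *)
have N0 w : N 0 w = 0%N.
  by apply/eqP; rewrite -(eqr_nat R); apply/eqP; exact: (levy_start LN).
rewrite poisson_weight0; have [->|k0] := eqVneq k 0%N.
  rewrite (_ : _ @^-1` _ = setT) ?probability_setT//.
  by apply/seteqP; split => // w _; exact: N0.
rewrite (_ : _ @^-1` _ = set0) ?measure0//.
by apply/seteqP; split => w //=; rewrite N0 => /esym/eqP; rewrite (negbTE k0).
Qed.

Lemma poisson_weight_ge0 l k t : 0 <= l -> 0 <= t -> 0 <= poisson_weight l k t.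
Proof.
by move=> l0 t0; rewrite /poisson_weight !mulr_ge0 ?expR_ge0 ?exprn_ge0 ?mulr_ge0.
Qed.

Lemma process_sigma_preimage d' (U : measurableType d') (X : R -> T -> U) t
    (B : set U) : 0 <= t -> measurable B -> process_sigma X (X t @^-1` B).
Proof.
by move=> t0 mB; apply: sub_gen_smallest; exists t => //; exists B.
Qed.

Variables (alpha beta : R).
Hypotheses (alpha_gt0 : 0 < alpha) (beta_gt0 : 0 < beta).

Section Gamma_process.
Variables (G : R -> T -> R).
Hypothesis HG : gamma_process P alpha beta G.

(** At time [a / alpha] the process has shape [a], and its law has total mass 1. *)
Lemma gamma_process_Gamma (a : R) : 0 < a -> Gamma_converges a /\ 0 < Gamma a.
Proof.
move=> a0; apply: (Gamma_total_mass beta_gt0).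
have [LG _ GE] := HG.
have t0 : 0 < a / alpha by rewrite divr_gt0.
have := GE (a / alpha) setT t0 measurableT.
have ta : alpha * (a / alpha) = a by rewrite mulrC divfK ?gt_eqF.
rewrite setTI ta => <-.
by rewrite preimage_setT probability_setT.
Qed.

Lemma gamma_process_Gamma_rising (a : R) k : 0 < a ->
  Gamma (a + k%:R) = rising_factorial a k * Gamma a.
Proof.
move=> a0; elim: k => [|k IH].
  by rewrite addr0 /rising_factorial big_ord0 mul1r.
have ak0 : 0 < a + k%:R by rewrite ltr_wpDr.
rewrite -natr1 addrA Gamma_recurrence.
- by rewrite IH rising_factorialS; ring.
- by have [] := gamma_process_Gamma ak0.
- by have [] := gamma_process_Gamma (addr_gt0 ak0 ltr01).
Qed.

Lemma gamma_process_poisson_weight l k n : 0 < l ->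
  (\int[P]_w (poisson_weight l k (G n%:R w))%:E)%E =
  (negbin_pmf l beta (alpha * n%:R) k)%:E.
Proof.
move=> l0; have [LG G0 GE] := HG.
case: n => [|n].
  rewrite mulr0 negbin_pmf0 -(poisson_weight0 l).
  under eq_integral do rewrite (levy_start LG).
  by rewrite (integral_cst P _ (poisson_weight l k 0)%:E)//= probability_setT mule1.
have an0 : 0 < alpha * n.+1%:R by rewrite mulr_gt0.
have [_ Ga] := gamma_process_Gamma an0.
have [Gak _] := gamma_process_Gamma (ltr_wpDr (ler0n R k) an0).
rewrite -(integral_gamma_pdf_poisson_weight l0 beta_gt0 Gak (lt0r_neq0 Ga))//;
  last exact: gamma_process_Gamma_rising.
have mGn : measurable_fun setT (G n.+1%:R) by exact: (levy_measurable LG).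
(* The density lemma asks for a function nonnegative on the whole line; the absolute value changes
   nothing at nonnegative times. *)
have mf : measurable_fun setT (fun x => (`|poisson_weight l k x|)%:E : \bar R).
  apply/measurable_EFinP; apply: measurableT_comp => //.
  by apply: continuous_measurable_fun; exact: continuous_poisson_weight.
have f0 x : (0 <= (`|poisson_weight l k x|)%:E :> \bar R)%E by rewrite lee_fin.
pose nu : {measure set R -> \bar R} :=
  measure_function_pushforward__canonical__measure_function_Measure P mGn.
transitivity (\int[nu]_x (`|poisson_weight l k x|)%:E)%E.
  rewrite ge0_integral_pushforward//.
  apply: eq_integral => w _ /=; rewrite ger0_norm//.
  by apply: poisson_weight_ge0; [exact: ltW|exact: G0].
transitivity (\int[lebesgue_measure]_(x in `]0%R, +oo[)
    ((gamma_pdf (alpha * n.+1%:R) beta x)%:E * (`|poisson_weight l k x|)%:E))%E.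
  apply: (@ge0_integral_density _ _ R (measurableTypeR R) R nu lebesgue_measure
    (fun x => x) (gamma_pdf (alpha * n.+1%:R) beta) `]0, +oo[%classic
    (fun x => (`|poisson_weight l k x|)%:E)) => //.
  - apply: measurable_funTS.
    rewrite (_ : gamma_pdf _ _ = (fun x => beta `^ (alpha * n.+1%:R) /
        Gamma (alpha * n.+1%:R) * gamma_kernel (alpha * n.+1%:R) beta x)).
      by apply: measurable_funM => //; exact: measurable_gamma_kernel.
    by apply/funext => x; rewrite gamma_pdfE.
  - by move=> x _; exact: gamma_pdf_ge0.
  - by move=> B mB; rewrite setIC; exact: GE.
apply: eq_integral => x; rewrite inE/= in_itv/= andbT => x0.
by rewrite ger0_norm// poisson_weight_ge0// ltW.
Qed.

End Gamma_process.

Section Compound_process.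
Variables (lambda : R) (Y : R -> T -> R).
Hypotheses (lambda_gt0 : 0 < lambda)
  (HY : compound_poisson_gamma P lambda alpha beta Y).

Lemma measurable_compound_process t : 0 <= t -> measurable_fun setT (Y t).
Proof.
move=> t0; have [N [G [HN [LG _ _] _ YE]]] := HY.
move=> _ B mB; rewrite setTI.
have -> : Y t @^-1` B = \bigcup_n (N t @^-1` [set n] `&` G n%:R @^-1` B).
  apply/seteqP; split => [w Bw|w [n _ [/= <-]]]; last by rewrite YE.
  by exists (N t w) => //; split => //=; rewrite -YE.
apply: bigcupT_measurable => n; apply: measurableI.
  exact: measurable_poisson_process HN t0.
by rewrite -[X in measurable X]setTI; exact: (levy_measurable LG).
Qed.

Lemma compound_process_ge0 t w : 0 <= t -> 0 <= Y t w.
Proof.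
by move=> t0; have [N [G [_ [_ G0 _] _ YE]]] := HY; rewrite YE// G0.
Qed.

(** Conditioning on [N t = n] replaces [Y t] by [G n], and independence of [N] and [G] factors each
    term. *)
Lemma compound_process_poisson_weight l k t : 0 < l -> 0 <= t ->
  (\int[P]_w (poisson_weight l k (Y t w))%:E =
   \sum_(n <oo) (poisson_weight lambda n t *
                 negbin_pmf l beta (alpha * n%:R) k)%:E)%E.
Proof.
move=> l0 t0; have [N [G [HN HG indepNG YE]]] := HY.
have [LG G0 _] := HG.
pose f n w : \bar R := (`|poisson_weight l k (G n%:R w)|)%:E.
have fE n w : f n w = (poisson_weight l k (G n%:R w))%:E.
  by rewrite /f ger0_norm//; apply: poisson_weight_ge0; [exact: ltW|exact: G0].
have mG n : measurable_fun setT (G n%:R) by exact: (levy_measurable LG).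
have mq : measurable_fun setT (fun x => (`|poisson_weight l k x|)%:E : \bar R).
  apply/measurable_EFinP; apply: measurableT_comp => //.
  by apply: continuous_measurable_fun; exact: continuous_poisson_weight.
transitivity (\int[P]_w f (N t w) w)%E.
  by apply: eq_integral => w _; rewrite fE YE.
rewrite ge0_integral_nat_partition.
- apply: eq_eseriesr => n _.
  rewrite (integral_indep (f := fun x => (`|poisson_weight l k x|)%:E))//.
  + rewrite -[X in (_ * X)%E]/(\int[P]_w f n w)%E.
    under eq_integral do rewrite fE.
    rewrite gamma_process_poisson_weight// [RHS]EFinM; congr (_ * _)%E.
    exact: poisson_process_prob.
  + exact: measurable_poisson_process HN t0.
  + by move=> B mB; apply: indepNG; exact: process_sigma_preimage.
- by move=> n; exact: measurable_poisson_process HN t0.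
- by move=> n; exact: (measurableT_comp mq (mG n)).
- by move=> n w; rewrite /f lee_fin.
Qed.

End Compound_process.
End Processes.

(** * Poisson averages as differentiable functions of time *)

Section Poisson_mean.
Context {R : realType}.
Implicit Types (c : nat -> R) (l t : R).

(* The mean of [c] at a Poisson variable of parameter [l * t]. *)
Definition poisson_mean c l t : R := expR (- (l * t)) * exp_series c (l * t).

(** Passes from the extended-real series of probabilities to a real function that can be
    differentiated. *)
Lemma eseries_poisson_weight c l t : (forall n, `|c n| <= 1) ->
  (\sum_(n <oo) (poisson_weight l n t * c n)%:E = (poisson_mean c l t)%:E)%E.
Proof.
move=> c1; apply/cvg_lim => //.
under eq_fun do rewrite sumEFin.
apply: cvg_EFin; first exact: nearW.
rewrite (_ : fine \o _ =
    (fun n => expR (- (l * t)) * pseries (fun i => c i / i`!%:R) (l * t) n)).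
  by apply: cvgM; [exact: cvg_cst|exact: is_cvg_exp_series].
apply/funext => n; rewrite /pseries /series/= mulr_sumr.
by apply: eq_bigr => i _; rewrite /poisson_weight; ring.
Qed.

(** The forward difference is the generator of the Poisson process: the series yields the shifted
    mean, the exponential factor the subtracted one. *)
Lemma is_derive_poisson_mean c l t : (forall n, `|c n| <= 1) ->
  is_derive t (1 : R) (poisson_mean c l)
    (l * poisson_mean (fun n => c n.+1) l t - l * poisson_mean c l t).
Proof.
move=> c1.
have dlin (a : R) : is_derive t (1 : R) (fun x => a * x) a.
  apply: is_derive_eq (is_deriveZ a (is_derive_id t 1)) _.
  by rewrite /GRing.scale/= mulr1.
have dE : is_derive t (1 : R) (expR \o (fun x => - l * x))
    (expR (- l * t) * - l).
  exact: is_derive1_comp (is_derive_expR _) (dlin _).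
have dS : is_derive t (1 : R) (exp_series c \o (fun x => l * x))
    (exp_series (fun n => c n.+1) (l * t) * l).
  exact: is_derive1_comp (is_derive_exp_series _ c1) (dlin _).
have fE : poisson_mean c l =
    (expR \o (fun x => - l * x)) * (exp_series c \o (fun x => l * x)).
  by apply/funext => x; rewrite /poisson_mean fctE /= mulNr.
rewrite {1}fE; apply: is_derive_eq (is_deriveM dE dS) _.
by rewrite /poisson_mean /GRing.scale/= -mulNr; ring.
Qed.

Lemma poisson_mean_sum (k : nat) (u : 'I_k -> R) (c : 'I_k -> nat -> R) l t :
  (forall m n, `|c m n| <= 1) ->
  poisson_mean (fun n => \sum_(m < k) u m * c m n) l t =
  \sum_(m < k) u m * poisson_mean (c m) l t.
Proof.
move=> c1; rewrite /poisson_mean exp_series_sum// mulr_sumr.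
by apply: eq_bigr => m _; rewrite mulrCA.
Qed.

(** The probability generating function of the Poisson law, at [r]. *)
Lemma poisson_mean_geometric (r l t : R) :
  poisson_mean (fun n => r ^+ n) l t = expR (- l * t * (1 - r)).
Proof.
by rewrite /poisson_mean exp_series_geometric -expRD; congr expR; ring.
Qed.

End Poisson_mean.

(** * The law of the time-changed process and its equations *)

Theorem theorem1 (R : realType) (d : measure_display) (T : measurableType d)
    (P : probability T R) (lambda lambda1 alpha beta : R)
    (lambda_gt0 : 0 < lambda) (lambda1_gt0 : 0 < lambda1)
    (alpha_gt0 : 0 < alpha) (beta_gt0 : 0 < beta)
    (N1 : R -> T -> nat) (GN : R -> T -> R)
    (HN1 : poisson_process P lambda1 N1)
    (HGN : compound_poisson_gamma P lambda alpha beta GN)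
    (Hindep : indep_processes P N1 GN) :
  let p := state_prob P (time_change N1 GN) in
  let rhs (k : nat) (t : R) :=
    (lambda * beta `^ alpha / (lambda1 + beta) `^ alpha - lambda) * p k t
    + lambda * beta `^ alpha / (lambda1 + beta) `^ alpha
      * \sum_(1 <= m < k.+1)
          lambda1 ^+ m / (lambda1 + beta) ^+ m
          * (Gamma (m%:R + alpha) / (m`!%:R * Gamma alpha))
          * p (k - m)%N t in
  [/\ forall (k : nat) (t : R), (1 <= k)%N -> 0 <= t ->
        (p k t)%:E =
        ((expR (- lambda * t) / k`!%:R
          * (lambda1 ^+ k / (lambda1 + beta) ^+ k))%:E
         * \sum_(1 <= n <oo)
             ((lambda * t * beta `^ alpha) ^+ n * Gamma (alpha * n%:R + k%:R)
              / ((lambda1 + beta) `^ (alpha * n%:R)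
                 * n`!%:R * Gamma (alpha * n%:R)))%:E)%E,
      forall t : R, 0 <= t ->
        p 0%N t =
        expR (- lambda * t * (1 - beta `^ alpha / (lambda1 + beta) `^ alpha)),
      forall (k : nat) (t : R), 0 < t -> is_derive t (1 : R) (p k) (rhs k t) &
      (* at t = 0 the derivative is the one-sided one *)
      forall k : nat, h^-1 * (p k h - p k 0) @[h --> 0^'+] --> rhs k 0].
Proof.
move=> p rhs.
have l1b : 0 < lambda1 + beta by rewrite addr_gt0.
have [_ [G [_ HG _ _]]] := HGN.
(* [c k n] is the probability that [N1 (G n) = k] *)
pose c k n := negbin_pmf lambda1 beta (alpha * n%:R) k.
have pw_le1 k t : 0 <= t -> poisson_weight lambda1 k t <= 1.
  move=> t0; rewrite -lee_fin -(poisson_process_prob _ lambda1_gt0 HN1)//.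
  by rewrite probability_le1//; exact: measurable_poisson_process HN1 t0.
have c0 k n : 0 <= c k n.
  apply: negbin_pmf_ge0; [exact: ltW|exact: ltW|].
  by apply: mulr_ge0 => //; exact: ltW.
(* As the mean of a Poisson probability evaluated at [G n], this weight is at most 1. *)
have c1 k n : `|c k n| <= 1.
  have G0 w : 0 <= G n%:R w by have [_ G0 _] := HG; exact: G0.
  have pw0 w : 0 <= poisson_weight lambda1 k (G n%:R w).
    by apply: poisson_weight_ge0; [exact: ltW|exact: G0].
  have cE := gamma_process_poisson_weight alpha_gt0 beta_gt0 HG k n lambda1_gt0.
  rewrite ger0_norm//.
  have mG : measurable_fun setT (G n%:R).
    by have [LG _ _] := HG; exact: (levy_measurable LG).
  have mpG : measurable_fun setT (fun w => poisson_weight lambda1 k (G n%:R w)).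
    apply: measurableT_comp mG.
    by apply: continuous_measurable_fun; exact: continuous_poisson_weight.
  rewrite -lee_fin -cE -(@probability_setT _ _ _ P).
  rewrite -[leRHS]mul1e -(integral_cst P measurableT 1%E).
  apply: ge0_le_integral => //.
  - by move=> w _; rewrite lee_fin.
  - exact/measurable_EFinP.
  - by move=> w _; rewrite lee_fin pw_le1.
have prob_eseries k t : 0 <= t -> P [set w | time_change N1 GN t w = k] =
    (\sum_(n <oo) (poisson_weight lambda n t * c k n)%:E)%E.
  move=> t0.
  rewrite -(compound_process_poisson_weight alpha_gt0 beta_gt0 lambda_gt0 HGN)//.
  apply: (prob_random_time (N := N1)).
  - exact: measurable_compound_process HGN _ t0.
  - by move=> w; exact: compound_process_ge0 HGN _ _ t0.
  - by move=> s s0; exact: measurable_poisson_process HN1 s0.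
  - by move=> w s s0; have [LN _] := HN1; exact: (levy_cadlag LN w).1 _ s0.
  - by move=> s s0; exact: poisson_process_prob.
  - by move=> s B s0 mB; apply: Hindep; exact: process_sigma_preimage.
  - exact: continuous_poisson_weight.
have pE k t : 0 <= t -> p k t = poisson_mean (c k) lambda t.
  by move=> t0; rewrite /p /state_prob prob_eseries// eseries_poisson_weight.
have r_alpha : (beta / (lambda1 + beta)) `^ alpha =
    beta `^ alpha / (lambda1 + beta) `^ alpha by rewrite powR_div// ltW.
have rhsE k t : 0 <= t -> rhs k t =
    lambda * poisson_mean (fun n => c k n.+1) lambda t -
    lambda * poisson_mean (c k) lambda t.
  move=> t0.
  (* Shape [alpha * (n + 1)] is [alpha] plus [alpha * n], so the shift is a convolution with the
     weights of shape [alpha]; its term [m = 0] gives the coefficient of [p k]. *)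
  have -> : (fun n => c k n.+1) =
      (fun n => \sum_(m < k.+1) c m 1%N * c (k - m)%N n).
    apply/funext => n; rewrite /c -natr1 mulrDr addrC negbin_pmf_conv//.
  rewrite poisson_mean_sum// big_ord_recl/= subn0 -!pE//.
  have c01 m : c m 1%N = beta `^ alpha / (lambda1 + beta) `^ alpha *
      (lambda1 ^+ m / (lambda1 + beta) ^+ m *
       (Gamma (m%:R + alpha) / (m`!%:R * Gamma alpha))).
    have [_ Ga] := gamma_process_Gamma alpha_gt0 beta_gt0 HG alpha_gt0.
    rewrite /c /negbin_pmf [alpha * _]mulr1 r_alpha expr_div_n [_ + alpha]addrC.
    rewrite (gamma_process_Gamma_rising alpha_gt0 beta_gt0 HG)// -mulrA.
    congr (_ * (_ * _)); field.
    by rewrite (gt_eqF Ga) pnatr_eq0 -lt0n fact_gt0.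
  rewrite /rhs big_add1 big_mkord/= mulr_sumr mulrDr mulr_sumr.
  rewrite mulrBl addrAC; congr (_ - _); congr (_ + _).
    rewrite /c /negbin_pmf [alpha * _]mulr1 r_alpha /rising_factorial big_ord0 expr0.
    by rewrite divr1 !mulr1 !mulrA.
  by apply: eq_bigr => m _; rewrite -pE// c01 /bump/= add1n !mulrA.
split.
- move=> k t k1 t0; rewrite pE// -eseries_poisson_weight//.
  have r0 : 0 <= lambda * t * beta `^ alpha by rewrite !mulr_ge0 ?powR_ge0 ?(ltW lambda_gt0).
  (* The term [n = 0] vanishes because [k >= 1], so the series may start at 1. *)
  rewrite (nneseries_split 0 1); last first.
    move=> n _; rewrite lee_fin mulr_ge0//.
    by apply: poisson_weight_ge0 => //; exact: ltW.
  rewrite big_nat1 /c mulr0 negbin_pmf0 gtn_eqF// mulr0 add0e.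
  rewrite -nneseriesZl; last first.
    move=> n _; rewrite lee_fin divr_ge0// ?mulr_ge0 ?Gamma_ge0 ?powR_ge0//.
    by rewrite exprn_ge0.
  apply: congr_lim; apply/funext => n; apply: eq_big_nat => -[//|i] _.
  have ai0 : 0 < alpha * i.+1%:R by rewrite mulr_gt0.
  have [_ Ga] := gamma_process_Gamma alpha_gt0 beta_gt0 HG ai0.
  rewrite -EFinM (gamma_process_Gamma_rising alpha_gt0 beta_gt0 HG)//.
  rewrite /poisson_weight /negbin_pmf expr_div_n (powR_div _ (ltW beta_gt0) (ltW l1b)).
  have bE : (beta `^ alpha) ^+ i.+1 = beta `^ (alpha * i.+1%:R).
    by rewrite powRrM powR_mulrn// powR_ge0.
  rewrite [(_ * _ * beta `^ alpha) ^+ _]exprMn bE mulNr.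
  congr (_%:E); field.
  rewrite (gt_eqF Ga) !pnatr_eq0 -!lt0n !fact_gt0 (gt_eqF (powR_gt0 _ l1b)).
  by rewrite expf_neq0// gt_eqF.
- move=> t t0; rewrite pE// -r_alpha -poisson_mean_geometric.
  (* For [k = 0] the weights are geometric in [n]. *)
  congr (poisson_mean _ _ _); apply/funext => n.
  by rewrite /c /negbin_pmf /rising_factorial big_ord0 expr0 divr1 !mulr1
    powRrM powR_mulrn ?powR_ge0.
- move=> k t t0; rewrite rhsE; last exact: ltW.
  (* The formula for [p k] is available at nonnegative times only; these contain a neighbourhood of
     [t > 0]. *)
  apply: near_eq_is_derive; last exact: is_derive_poisson_mean.
  near=> s; rewrite pE//; apply: ltW.
  by near: s; exact: lt_nbhsr.
- move=> k; rewrite rhsE//.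
  (* The Poisson mean is differentiable at 0 from both sides, and its right quotients are those of
     [p k]. *)
  have := is_derive_cvg_right (is_derive_poisson_mean lambda 0 (c1 k)).
  apply: cvg_trans; apply: near_eq_cvg; near=> h.
  by rewrite add0r !pE.
Unshelve. all: by end_near. Qed.
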